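(* Let $q>1$ be real. (i) Let $v:=b_{\ell+1}(y,q)\ldots b_{\ell+m}(y,q)$ for some $y\in[0,1)$ and some integers $\ell\ge0$, $m\ge1$. Then the set $Y_v$ of numbers $x\in J_q$ such that the word $v$ does not occur (as a block of consecutive digits) in the greedy expansion $(b_i(x,q))$ has Hausdorff dimension less than one. (ii) The set $Y$ of numbers $x\in J_q$ for which at least one word of the form $b_{\ell+1}(y,q)\ldots b_{\ell+m}(y,q)$ (with $\ell\ge0$, $m\ge1$, $y\in[0,1)$) does not occur in the greedy expansion of $x$ in base $q$ is of first category, has Lebesgue measure zero and has Hausdorff dimension one.
   Context: For real $q>1$ let $\lceil q\rceil$ be the smallest integer $\ge q$, $A_q=\{0,\ldots,\lceil q\rceil-1\}$ and $J_q=[0,(\lceil q\rceil-1)/(q-1)]$. For $x\in J_q$ the greedy expansion $(b_i(x,q))$ is defined recursively: $b_n(x,q)$ is the largest element of $A_q$ with $\sum_{i=1}^n b_i(x,q)q^{-i}\le x$. *)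

(* Defs.v *)
From HB Require Import structures.
From mathcomp Require Import all_boot all_order all_algebra.
From mathcomp Require Import all_classical all_reals all_analysis.
Set Implicit Arguments. Unset Strict Implicit. Unset Printing Implicit Defensive.
Import Order.TTheory GRing.Theory Num.Theory.
Import numFieldNormedType.Exports.
Local Open Scope classical_set_scope.
Local Open Scope ring_scope.

Section Defs.
Variable R : realType.

(** ceil q (as a natural number; q > 1 so it is positive) *)
Definition ceilq (q : R) : nat := `|Num.ceil q|%N.

Definition Jq (q : R) : set R :=
  [set x | 0 <= x <= ((ceilq q)%:R - 1) / (q - 1)].

Definition greedy_digit (x q S : R) (n : nat) : nat :=
  \max_(d < ceilq q | S + (val d)%:R / q ^+ n <= x) val d.

Fixpoint greedy_psum (x q : R) (n : nat) : R :=
  match n with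
  | 0 => 0
  | n'.+1 => greedy_psum x q n' + (greedy_digit x q (greedy_psum x q n') n)%:R / q ^+ n
  end.

(** b_n(x,q), for n >= 1 (paper's indexing; b_0 is meaningless) *)
Definition greedy (x q : R) (n : nat) : nat :=
  greedy_digit x q (greedy_psum x q n.-1) n.

Definition word_occurs (q x y : R) (l m : nat) : Prop :=
  exists k : nat, forall i : nat, (i < m)%N ->
    greedy x q (k + 1 + i) = greedy y q (l + 1 + i).

Definition Yv (q y : R) (l m : nat) : set R :=
  [set x | Jq q x /\ ~ word_occurs q x y l m].

Definition Yset (q : R) : set R :=
  [set x | Jq q x /\ exists (y : R) (l m : nat),
     [/\ 0 <= y < 1, (0 < m)%N & ~ word_occurs q x y l m]].

Definition diam_le (U : set R) (d : R) : Prop :=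
  forall x y, U x -> U y -> `|x - y| <= d.

Definition diam (U : set R) : R := sup [set `|x - y| | x in U & y in U].

Definition hcost (s : R) (U : set R) : R :=
  if `[< U = set0 >] then 0 else powR (diam U) s.

Definition hausdorff_pre (s delta : R) (A : set R) : \bar R :=
  ereal_inf [set (\sum_(0 <= i <oo) (hcost s (U i))%:E)%E |
     U in [set U : nat -> set R |
             A `<=` \bigcup_i U i /\ forall i, diam_le (U i) delta]].

(** H^s(A) = lim_{delta -> 0+} H^s_delta(A) = sup_{delta>0} H^s_delta(A) *)
Definition hausdorff_measure (s : R) (A : set R) : \bar R :=
  ereal_sup [set hausdorff_pre s delta A | delta in [set d : R | 0 < d]].

Definition hausdorff_dim (A : set R) : \bar R :=
  ereal_inf [set s%:E | s in [set s : R | 0 <= s /\ hausdorff_measure s A = 0%E]].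

Definition nowhere_dense (A : set R) : Prop := (closure A)° = set0.

Definition first_category (A : set R) : Prop :=
  exists F : nat -> set R, (forall n, nowhere_dense (F n)) /\ A `<=` \bigcup_n F n.

End Defs.

(* Main.v *)
(* Digits of the greedy expansion are read off the orbit of x under the greedy
   map T, which on [0,1) is T x = q x mod 1.  The points of [0,1) whose expansion
   starts with v contain a nondegenerate interval [a,b), so Y_v essentially lies
   in the set Z of points of [0,1) whose orbit avoids [a,b).  Subdividing
   [0,a) and [b,1) by the branches of T^j for j <= K covers Z by finitely many
   affine copies of itself whose ratios sum to less than 1: only K+2 of the pieces
   are not images of the whole of [0,1), and counting these with the ratio q^-K
   adds at most (K+2) q^-K to the length 1-(b-a).  Hence the sum of the
   s-th powers of the ratios is still less than 1 for some s < 1, and Z has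
   dimension at most s.  The same covers at s = 1 are finite, so Y_v and even its
   closure are Lebesgue null, and Y is a countable union of such sets.

   Conversely, every interval of length (n+1) q^-n in [0,1) contains a full interval
   of length q^-n, that is, one which T^n maps affinely onto [0,1).
   Full intervals away from 0, spaced by gaps, give a Cantor set of expansions
   without the word 0^(2n), and the number of pieces is large enough for its
   dimension to tend to 1 with n. *)
Require Import Defs.
From HB Require Import structures.
From mathcomp Require Import all_boot all_order all_algebra.
From mathcomp Require Import all_classical all_reals all_analysis.
From mathcomp Require Import measurable_realfun ring lra.
Import Order.TTheory GRing.Theory Num.Theory.
Import numFieldNormedType.Exports.
Local Open Scope classical_set_scope.
Local Open Scope ring_scope.

Set Implicit Arguments.
Unset Strict Implicit.

(** * Greedy digits read off the orbit of a piecewise affine map *)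

Section GreedyMap.
Variables (R : realType) (q : R).
Hypothesis hq : 1 < q.

Definition digit (x : R) : nat := \max_(d < ceilq q | (val d)%:R <= q * x) val d.

Definition greedy_map (x : R) : R := q * x - (digit x)%:R.

Lemma ceilq_natr : (ceilq q)%:R = (Num.ceil q)%:~R :> R.
Proof.
by rewrite /ceilq natr_absz ger0_norm// ceil_ge0 (lt_trans _ hq)// (lt_trans _ ltr01)// ltrN10.
Qed.

Lemma ceilq_ge : q <= (ceilq q)%:R.
Proof. by rewrite ceilq_natr; have /andP[] := ceil_itv q. Qed.

Lemma ceilq_gt1 : (1 < ceilq q)%N.
Proof. by rewrite -(ltr_nat R); exact: lt_le_trans hq ceilq_ge. Qed.

Lemma digit_le_predceil x : (digit x <= (ceilq q).-1)%N.
Proof.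
apply/bigmax_leqP => i _; rewrite -ltnS prednK ?ltn_ord//.
exact: ltn_trans ceilq_gt1.
Qed.

Lemma digit_lt_ceil x : (digit x < ceilq q)%N.
Proof.
by rewrite (leq_ltn_trans (digit_le_predceil x))// prednK// (ltn_trans _ ceilq_gt1).
Qed.

Lemma digit_le x : 0 <= x -> (digit x)%:R <= q * x.
Proof.
move=> x0; rewrite /digit; elim/big_ind : _ => //.
- by rewrite mulr_ge0// ltW// (lt_trans ltr01 hq).
- by move=> m n hm hn; rewrite /maxn; case: ifP.
Qed.

Lemma leq_digit x d : (d < ceilq q)%N -> d%:R <= q * x -> (d <= digit x)%N.
Proof.
by move=> hd hdx; rewrite -[d]/(val (Ordinal hd)); exact: leq_bigmax_cond.
Qed.

Lemma digit_uniq x d : 0 <= x -> (d < ceilq q)%N -> d%:R <= q * x < d%:R + 1 ->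
  digit x = d.
Proof.
move=> x0 dc /andP[dx xd]; apply/eqP; rewrite eqn_leq leq_digit// andbT.
by rewrite -ltnS -(ltr_nat R) -addn1 natrD (le_lt_trans (digit_le x0)).
Qed.

(** From 1 on, the alphabet is what limits the digit: [q * x >= q] exceeds its largest letter. *)
Lemma digit_ge1 x : 1 <= x -> digit x = (ceilq q).-1.
Proof.
move=> x1; apply/eqP; rewrite eqn_leq digit_le_predceil leq_digit//.
  by rewrite prednK// (ltn_trans _ ceilq_gt1).
have : q <= q * x by rewrite ler_peMr// ltW// (lt_trans ltr01 hq).
apply: le_trans; apply: ltW.
rewrite -subn1 natrB; last exact: (ltn_trans _ ceilq_gt1).
by rewrite ceilq_natr; have /andP[+ _] := ceil_itv q; rewrite intrB.
Qed.

Lemma lt_digitS x : x < 1 -> q * x < (digit x)%:R + 1.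
Proof.
move=> x1; rewrite ltNge; apply/negP => h.
have hlt : ((digit x).+1 < ceilq q)%N.
  rewrite -(ltr_nat R) -addn1 natrD (le_lt_trans h)//.
  by rewrite (lt_le_trans _ ceilq_ge)// gtr_pMr// (lt_trans ltr01 hq).
have := @leq_digit x _ hlt; rewrite -addn1 natrD => /(_ h).
by rewrite addn1 ltnn.
Qed.

Lemma le_digitS x : x <= 1 -> q * x <= (digit x)%:R + 1.
Proof.
rewrite le_eqVlt => /orP[/eqP ->|/lt_digitS/ltW//].
by rewrite digit_ge1// mulr1 natr1 prednK ?ceilq_ge// (ltn_trans _ ceilq_gt1).
Qed.

Lemma le_digit x y : x <= y -> (digit x <= digit y)%N.
Proof.
move=> xy; apply/bigmax_leqP => d /= hd; apply: leq_digit => //.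
by apply: (le_trans hd); rewrite ler_pM2l// (lt_trans ltr01 hq).
Qed.

Lemma greedy_map_itv x : 0 <= x < 1 -> 0 <= greedy_map x < 1.
Proof.
move=> /andP[x0 x1]; rewrite /greedy_map subr_ge0 digit_le//=.
by rewrite ltrBlDr addrC lt_digitS.
Qed.

Lemma iter_greedy_map_itv n x : 0 <= x < 1 -> 0 <= iter n greedy_map x < 1.
Proof. by elim: n => //= n ih /ih; exact: greedy_map_itv. Qed.

Lemma greedy_mapK x : x = ((digit x)%:R + greedy_map x) / q.
Proof.
by rewrite /greedy_map addrC subrK mulrC mulKf// gt_eqF// (lt_trans ltr01 hq).
Qed.

Lemma greedy_map_branch d z : (d < ceilq q)%N -> 0 <= z < 1 ->
  greedy_map ((d%:R + z) / q) = z.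
Proof.
move=> dc /andP[z0 z1]; have q0 := lt_trans ltr01 hq.
have e : q * ((d%:R + z) / q) = d%:R + z by rewrite mulrC divfK// gt_eqF.
have dE : digit ((d%:R + z) / q) = d.
  apply: digit_uniq => //; first by rewrite divr_ge0 ?addr_ge0// ltW.
  by rewrite e lerDl z0 /= ltrD2l.
by rewrite /greedy_map dE e addrAC subrr add0r.
Qed.

(** Partial sums and orbits are linked by the remainder rescaled by [q ^+ n]: the next digit is read
    off it. *)
Lemma greedy_remainder x n :
  q ^+ n * (x - greedy_psum x q n) = iter n greedy_map x /\
  greedy x q n.+1 = digit (iter n greedy_map x).
Proof.
have q0 := lt_trans ltr01 hq.
have digitE S k : greedy_digit x q S k.+1 = digit (q ^+ k * (x - S)).
  rewrite /greedy_digit /digit; apply: eq_bigl => d.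
  rewrite -lerBrDl ler_pdivrMr ?exprn_gt0// exprS.
  by rewrite mulrC -mulrA.
elim: n => [|n [ih ihd]].
  by rewrite expr0 mul1r /= subr0; split=> //; rewrite /greedy digitE /= expr0 mul1r subr0.
have e : q ^+ n.+1 * (x - greedy_psum x q n.+1) = iter n.+1 greedy_map x.
  rewrite iterS -ih /greedy_map -digitE [greedy_psum x q n.+1]/=.
  rewrite opprD addrA mulrBr exprS mulrA; congr (_ - _).
  by rewrite mulrC divfK// mulf_neq0// ?expf_neq0// gt_eqF.
by split=> //; rewrite -e /greedy digitE.
Qed.

Lemma greedyE x n : greedy x q n.+1 = digit (iter n greedy_map x).
Proof. by have [] := greedy_remainder x n. Qed.

End GreedyMap.

(** * Sets with finite covers of arbitrarily small cost *)

Section SmallSets.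
Variable R : realType.
Implicit Types (s eps : R) (A Z : set R) (L : seq (R * R)).

(* A pair [(a, r)] stands for the closed interval [[a, a + r]] in a cover and
    for the affine map [z |-> a + r z] in an iterated function system. *)
Definition interval_cover L A :=
  (forall t, t \in L -> 0 <= t.2) /\
  (forall x, A x -> exists2 t, t \in L & t.1 <= x <= t.1 + t.2).

(** Covers are finite so that smallness passes to closures. For s > 0 a small cost by itself forces
    short intervals. *)
Definition small s A :=
  forall eps, 0 < eps ->
    exists2 L, interval_cover L A & \sum_(t <- L) t.2 `^ s <= eps.

Lemma sub_small s A Z : A `<=` Z -> small s Z -> small s A.
Proof.
move=> AZ sZ e /sZ[L [L0 LZ] Le]; exists L => //; split=> // x /AZ; exact: LZ.
Qed.

Lemma small_set0 s : small s set0.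
Proof.
move=> e e0; exists [::]; first by split=> // x [].
by rewrite big_nil ltW.
Qed.

(* [A] is covered by affine copies of itself, up to the small set [Z]; iterating
   this [k] times makes the self-similar part of the cost geometric in [k]. *)
Lemma small_self_affine s A Z L B :
  0 < s -> (forall x, A x -> 0 <= x <= B) ->
  (forall t, t \in L -> 0 <= t.2) -> \sum_(t <- L) t.2 `^ s < 1 ->
  small s Z ->
  (forall x, A x -> Z x \/
     exists2 t, t \in L & exists2 z, A z & x = t.1 + t.2 * z) ->
  small s A.
Proof.
move=> s0 AB L0 L1 sZ AL e e0.
set sg := \sum_(t <- L) t.2 `^ s in L1.
have sg0 : 0 <= sg by apply: sumr_ge0 => t _; exact: powR_ge0.
(* This budget for [Z] makes [e / 2] a fixed point of [c |-> (1 - sg) * (e / 2) + sg * c], the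
   recursion satisfied by the costs. *)
have e'0 : 0 < (1 - sg) * (e / 2) by rewrite mulr_gt0 ?subr_gt0// divr_gt0.
have [LZ [LZ0 LZZ] LZe] := sZ _ e'0.
have [B0|B0] := ltP B 0.
  exists [::]; last by rewrite big_nil ltW.
  split=> // x /AB /andP[x0 /(le_trans x0)]; by rewrite leNgt B0.
have iterate k : exists2 M, interval_cover M A &
    \sum_(t <- M) t.2 `^ s <= e / 2 + sg ^+ k * B `^ s.
  elim: k => [|k [M [M0 MA] Me]].
    exists [:: (0, B)].
      split=> [t|x /AB xB]; first by rewrite inE => /eqP ->.
      exists (0, B); [by rewrite inE|by rewrite /= add0r].
    by rewrite big_seq1/= expr0 mul1r lerDr divr_ge0// ltW.
  exists (LZ ++ [seq (f.1 + f.2 * t.1, f.2 * t.2) | f <- L, t <- M]).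
    split=> [t|x Ax].
      rewrite mem_cat => /orP[/LZ0//|/allpairsP[[f u]/= [fL uM ->]]/=].
      by rewrite mulr_ge0 ?(L0 _ fL) ?(M0 _ uM).
    have [/LZZ[t tL xt]|[f fL [z Az ->]]] := AL _ Ax.
      by exists t; rewrite // mem_cat tL.
    have [t tM /andP[tz zt]] := MA _ Az.
    exists (f.1 + f.2 * t.1, f.2 * t.2).
      by rewrite mem_cat; apply/orP; right; apply/allpairsP; exists (f, t).
    by rewrite /= -addrA -mulrDr !lerD2l !ler_wpM2l// L0.
  rewrite big_cat/= big_allpairs_dep/=.
  rewrite [X in _ + X](_ : _ = sg * \sum_(t <- M) t.2 `^ s); last first.
    rewrite /sg mulr_suml big_seq [RHS]big_seq; apply: eq_bigr => f fL.
    rewrite mulr_sumr big_seq [RHS]big_seq; apply: eq_bigr => t tM.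
    by rewrite powRM ?(L0 _ fL) ?(M0 _ tM).
  rewrite (le_trans (lerD LZe (ler_wpM2l sg0 Me)))//.
  by rewrite mulrDr addrA -mulrDl subrK mul1r mulrA -exprS.
have : (fun k => sg ^+ k * B `^ s) @ \oo --> (0 : R).
  rewrite -[X in _ --> X](mul0r (B `^ s)); apply: cvgMr_tmp.
  by apply: cvg_expr; rewrite ger0_norm.
move=> /cvgrPdist_lt /(_ (e / 2)) [|N _ /(_ N (leqnn N))]; first by rewrite divr_gt0.
rewrite /= sub0r normrN ger0_norm; last by rewrite mulr_ge0 ?exprn_ge0// powR_ge0.
move=> hN; have [M MA Me] := iterate N; exists M => //.
by rewrite (le_trans Me)// [leRHS](splitr e) lerD2l ltW.
Qed.

Lemma small_hausdorff_measure s A : 0 < s -> small s A -> hausdorff_measure s A = 0%E.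
Proof.
move=> s0 sA.
have hc0 (U : set R) : 0 <= hcost s U.
  by rewrite /hcost; case: asboolP => // _; exact: powR_ge0.
have pre0 d : (0 <= hausdorff_pre s d A)%E.
  by apply: le_ereal_inf_tmp => _ [U _ <-]; apply: nneseries_ge0 => *; rewrite lee_fin.
have preE d : 0 < d -> hausdorff_pre s d A = 0%E.
  move=> d0; apply/eqP; rewrite eq_le pre0 andbT; apply/lee_addgt0Pr => e e0.
  rewrite add0e.
  (* Keeping the cost below d^s as well forces every interval to have length at most [d]. *)
  have m0 : 0 < Num.min e (d `^ s) by rewrite lt_min e0 powR_gt0.
  have [L [L0 LA] Le] := sA _ m0.
  pose I t := `[t.1, t.1 + t.2]%classic : set R.
  pose U i := if (i < size L)%N then I (nth (0, 0) L i) else set0.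
  have IL (t : R * R) x y : I t x -> I t y -> `|x - y| <= t.2.
    rewrite /I /= !in_itv/= => /andP[tx xt] /andP[ty yt].
    by rewrite ler_norml; apply/andP; split; lra.
  have hcI (t : R * R) : 0 <= t.2 -> hcost s (I t) <= t.2 `^ s.
    move=> t0; rewrite /hcost; case: asboolP => [_|_]; first exact: powR_ge0.
    have It : I t t.1 by rewrite /I /= in_itv/= lexx lerDl.
    have Dt : diam (I t) <= t.2.
      apply: ge_sup; first by exists 0; exists t.1 => //; exists t.1 => //; rewrite subrr normr0.
      by move=> _ [x Ix [y Iy <-]]; exact: IL.
    apply: ge0_ler_powR; rewrite ?nnegrE ?(ltW s0)//.
    apply: ub_le_sup; last by exists t.1 => //; exists t.1 => //; rewrite subrr normr0.
    by exists t.2 => _ [x Ix [y Iy <-]]; exact: IL.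
  apply: ge_ereal_inf; exists (\sum_(0 <= i <oo) (hcost s (U i))%:E)%E.
    exists U => //; split.
      move=> x /LA[t tL xt]; exists (index t L) => //.
      by rewrite /U index_mem tL nth_index// /I /= in_itv.
    move=> i x y; rewrite /U; case: ifP => // iL /IL h /h /le_trans; apply.
    set t := nth _ _ _; have tL : t \in L by exact: mem_nth.
    have : t.2 `^ s <= d `^ s.
      have := le_trans Le (_ : _ <= d `^ s); rewrite ge_min lexx orbT => /(_ isT).
      apply: le_trans; rewrite (big_rem t)//= lerDl sumr_ge0// => *; exact: powR_ge0.
    apply: contraTT; rewrite -!ltNge => dt.
    by apply: gt0_ltr_powR => //; rewrite nnegrE; [exact: ltW|exact: L0].
  rewrite (@nneseries_split _ _ 0 (size L)); last by move=> *; rewrite lee_fin.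
  rewrite add0n [X in (_ + X)%E]eseries0; last first.
    by move=> i iL _; rewrite /U ltnNge iL /= /hcost; case: asboolP.
  rewrite adde0 sumEFin lee_fin.
  apply: (@le_trans _ _ (Num.min e (d `^ s))); last by rewrite ge_min lexx.
  apply: le_trans Le.
  rewrite (big_nth (0, 0)) ler_sum_nat// => i /andP[_ iL].
  by rewrite /U iL; apply: hcI; apply: L0; exact: mem_nth.
apply/eqP; rewrite eq_le; apply/andP; split.
  by apply: ge_ereal_sup => _ [d /= d0 <-]; rewrite preE.
by apply: le_ereal_sup_tmp; exists (hausdorff_pre s 1 A) => //; exists 1 => //=.
Qed.

Lemma hausdorff_dim_le s A : 0 < s -> small s A -> (hausdorff_dim A <= s%:E)%E.
Proof.
move=> s0 sA; apply: ge_ereal_inf; exists s%:E => //; exists s => //.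
by split; [exact: ltW|exact: small_hausdorff_measure].
Qed.

(** A finite union of closed intervals is closed, so a cover of [A] already covers its closure. *)
Lemma small1_closure A : small 1 A -> small 1 (closure A).
Proof.
move=> sA e /sA[L [L0 LA] Le]; exists L => //; split=> // x clx.
have : (\big[setU/set0]_(t <- L) `[t.1, t.1 + t.2]%classic) x.
  have cl : closed (\big[setU/set0]_(t <- L) (`[t.1, t.1 + t.2]%classic : set R)).
    by apply: closed_bigsetU => t _; exact: interval_closed.
  apply: cl; apply: closureS clx => y /LA[t tL ty].
  by rewrite -bigcup_seq; exists t => //=; rewrite in_itv.
by rewrite -bigcup_seq => -[t /= tL]; rewrite in_itv/=; exists t.
Qed.

Lemma small1_lebesgue_measure A : measurable A -> small 1 A ->
  lebesgue_measure A = 0%E.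
Proof.
move=> mA sA; apply/eqP; rewrite eq_le measure_ge0 andbT.
apply/lee_addgt0Pr => e /sA[L [L0 LA] Le]; rewrite add0e.
pose I (t : R * R) := `[t.1, t.1 + t.2]%classic : set R.
have mI t : measurable (I t) by exact: measurable_itv.
have : (lebesgue_measure A <= \sum_(t <- L) lebesgue_measure (I t))%E.
  apply: (@le_trans _ _ (lebesgue_measure (\big[setU/set0]_(t <- L) I t))).
    apply: le_measure.
    - by rewrite inE.
    - by rewrite inE; apply: bigsetU_measurable => t _; exact: mI.
    by move=> x /LA[t tL xt]; rewrite -bigcup_seq; exists t => //=; rewrite /I /= in_itv.
  elim: (L) => [|t M ih]; first by rewrite !big_nil measure0.
  rewrite !big_cons; apply: (@le_trans _ _ (_ + _)%E); last exact: leeD2l ih.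
  apply: measureU2; first exact: mI.
  by apply: bigsetU_measurable => u _; exact: mI.
move=> /le_trans; apply; rewrite (_ : \sum_(t <- L) _ = (\sum_(t <- L) t.2)%:E)%E.
  by rewrite lee_fin (le_trans _ Le)// big_seq [leRHS]big_seq ler_sum// => t tL; rewrite powRr1// L0.
rewrite -sumEFin big_seq [RHS]big_seq; apply: eq_bigr => t tL.
rewrite lebesgue_measure_itv/= lte_fin; case: ifPn => [_|].
  by rewrite -EFinB addrAC subrr add0r.
by rewrite ltrDl -leNgt => t0; congr (_%:E); apply/eqP; rewrite eq_le L0.
Qed.

Lemma small1_negligible A : small 1 A -> (@lebesgue_measure R).-negligible A.
Proof.
move=> /small1_closure sA; exists (closure A); split; last exact: subset_closure.
  by apply: closed_measurable; exact: closed_closure.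
by apply: small1_lebesgue_measure => //; apply: closed_measurable; exact: closed_closure.
Qed.

(** An interior point of the closure would put an interval of positive length inside a null set. *)
Lemma small1_nowhere_dense A : small 1 A -> nowhere_dense A.
Proof.
move=> /small1_closure sA.
have mA : measurable (closure A) by apply: closed_measurable; exact: closed_closure.
apply/seteqP; split=> // x.
rewrite /interior/= => /nbhs_ballP[e /= e0 xeA].
have := small1_lebesgue_measure mA sA.
pose J := `[(x : R), x + e / 2]%classic : set R.
have : (lebesgue_measure J <= lebesgue_measure (closure A))%E.
  apply: le_measure; rewrite ?inE//; first exact: measurable_itv.
  move=> y; rewrite /J /= in_itv/= => /andP[xy ye]; apply: xeA.
  by rewrite /ball/= distrC ger0_norm ?subr_ge0//; lra.
move=> /[swap] ->; rewrite /J lebesgue_measure_itv/= lte_fin ltrDl divr_gt0//.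
by rewrite -EFinB addrAC subrr add0r lee_fin leNgt divr_gt0.
Qed.

(** Two half-size copies cover the interval, and 2 * 2^-s < 1. *)
Lemma small_bounded s B : 1 < s -> small s [set x | 0 <= x <= B].
Proof.
move=> s1.
have s0 : 0 < s by exact: lt_trans s1.
have h2 : 2^-1 `^ s < 2^-1 :> R.
  rewrite -[s](subrK 1) powRD; last by apply/implyP => _; rewrite invr_eq0 pnatr_eq0.
  rewrite powRr1// gtr_pMl ?invr_gt0//.
  have e1 : 1 `^ (s - 1) = 1 :> R by rewrite powR1.
  rewrite -[ltRHS]e1 gt0_ltr_powR ?nnegrE ?subr_gt0//.
  by rewrite invf_lt1// ltr1n.
apply: (@small_self_affine s _ set0 [:: (0, 2^-1); (B / 2, 2^-1)] B) => //.
- by move=> t; rewrite !inE => /orP[]/eqP ->; rewrite /= invr_ge0.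
- by rewrite !big_cons big_nil addr0 [ltRHS](splitr 1) div1r /= ltrD.
- exact: small_set0.
move=> x /= /andP[x0 xB]; right; have [xh|xh] := lerP x (B / 2).
  exists (0, 2^-1); first by rewrite inE eqxx.
  by exists (x * 2); rewrite /=; [apply/andP; split; lra|field].
exists (B / 2, 2^-1); first by rewrite !inE eqxx orbT.
by exists (x * 2 - B); rewrite /=; [apply/andP; split; lra|field].
Qed.

End SmallSets.

(** * Growth and continuity estimates *)

(** Bernoulli's inequality for the square root of [x], squared, gives a quadratic lower bound. *)
Lemma exp_gt_linear (R : realType) (x C : R) : 1 < x ->
  exists n, C * (n%:R + 4) < x ^+ n.
Proof.
move=> x1; have x0 : 0 <= x by rewrite ltW// (lt_trans ltr01).
pose t := Num.sqrt x; have t1 : 1 < t by rewrite -[ltLHS]sqrtr1 ltr_sqrt // (lt_trans ltr01 x1).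
have xt : x = t ^+ 2 by rewrite sqr_sqrtr.
have bernoulli n : 1 + n%:R * (t - 1) <= t ^+ n.
  elim: n => [|n ih]; first by rewrite mul0r addr0 expr0.
  rewrite exprS (le_trans _ (ler_wpM2l _ ih))//; last by rewrite ltW// (lt_trans ltr01).
  rewrite -subr_ge0 -natr1 [leRHS](_ : _ = n%:R * (t - 1) ^+ 2); last by ring.
  by rewrite mulr_ge0// sqr_ge0.
pose e := (t - 1) ^+ 2; have e0 : 0 < e by rewrite exprn_gt0// subr_gt0.
(* For n > [C'] and n >= 4 one has C (n + 4) <= 2 |C| n < e n^2. *)
pose C' := `|C| * 2 / e.
exists (Num.truncn C' + 4)%N; set n := (_ + _)%N.
have nC : C' < n%:R.
  by rewrite (lt_le_trans (truncnS_gt _))// ler_nat /n -addn1 leq_add2l.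
have n4 : 4 <= n%:R :> R by rewrite ler_nat leq_addl.
have h1 : C * (n%:R + 4) <= `|C| * 2 * n%:R.
  rewrite (le_trans (ler_wpM2r _ (ler_norm C)))//.
  by rewrite -mulrA ler_wpM2l//; lra.
have h2 : `|C| * 2 * n%:R < e * n%:R * n%:R.
  rewrite ltr_pM2r; last by rewrite (lt_le_trans _ n4).
  by move: nC; rewrite /C' ltr_pdivrMr// [_ * e]mulrC.
rewrite (le_lt_trans h1)// (lt_le_trans h2)// xt -exprM mulnC exprM.
have := bernoulli n; rewrite /e => hb.
have h0 : 0 <= n%:R * (t - 1) by rewrite mulr_ge0// subr_ge0 ltW.
rewrite [leLHS](_ : _ = (n%:R * (t - 1)) ^+ 2); last by ring.
by rewrite lerXn2r ?nnegrE//; lra.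
Qed.

(** Since the ratios are positive, the sum is continuous in the exponent, so it stays below 1
    slightly to the left of exponent 1. *)
Lemma contraction_exponent (R : realType) (L : seq (R * R)) :
  (forall t, t \in L -> 0 < t.2) -> \sum_(t <- L) t.2 < 1 ->
  exists2 s : R, 0 < s < 1 & \sum_(t <- L) t.2 `^ s < 1.
Proof.
move=> L0 L1.
have cvL : (fun s : R => \sum_(t <- L) t.2 `^ s) @ (1 : R) --> \sum_(t <- L) t.2.
  elim: L L0 {L1} => [_|t L ih L0].
    under eq_fun do rewrite big_nil.
    by rewrite big_nil; exact: cvg_cst.
  under eq_fun do rewrite big_cons.
  rewrite big_cons; apply: cvgD; last by apply: ih => u uL; apply: L0; rewrite inE uL orbT.
  have t0 : 0 < t.2 by apply: L0; rewrite inE eqxx.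
  rewrite /powR gt_eqF// -{2}[t.2]lnK ?posrE//.
  rewrite -{2}[ln t.2]mul1r.
  apply: (@continuous_comp _ _ _ (fun s : R => s * ln t.2) expR).
    by apply: cvgMr_tmp; exact: cvg_id.
  exact: continuous_expR.
have : \forall s \near (1 : R), \sum_(t <- L) t.2 `^ s < 1 by apply: cvgr_lt cvL _ L1.
move=> /nbhs_ballP[e /= e0 he].
pose d := Num.min e 1 / 2.
have d0 : 0 < d by rewrite divr_gt0// lt_min e0 ltr01.
have de : d < e by rewrite /d; have := ge_min e e 1; rewrite lexx /=; lra.
have d1 : d < 1 by rewrite /d; have := ge_min 1 e 1; rewrite lexx orbT; lra.
exists (1 - d); first by apply/andP; split; lra.
by apply: he; rewrite /ball/= opprB addrCA subrr addr0 gtr0_norm.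
Qed.

(** * Orbits avoiding an interval, and smallness of Y_v *)

Section AvoidingOrbits.
Variables (R : realType) (q : R).
Hypothesis hq : 1 < q.

Let q0 : 0 < q. Proof. exact: lt_trans ltr01 hq. Qed.

Let qn0 : q != 0. Proof. by rewrite gt_eqF. Qed.

(** [A] selects the points to be covered, but the copies are of all of [Z]: a piece cut by an
    endpoint may be covered wastefully by a full copy. *)
Definition affine_cover (L : seq (R * R)) (Z A : set R) :=
  (forall t, t \in L -> 0 < t.2) /\
  (forall x, Z x -> A x ->
     exists2 t, t \in L & exists2 z, Z z & x = t.1 + t.2 * z).

Definition branch (d : nat) (L : seq (R * R)) :=
  [seq ((d%:R + t.1) / q, t.2 / q) | t <- L].

Definition full_branches (m n : nat) : seq (R * R) :=
  [seq (d%:R / q, q^-1) | d <- iota m n].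

Lemma sum_branch d L : \sum_(t <- branch d L) t.2 = (\sum_(t <- L) t.2) / q.
Proof. by rewrite /branch big_map mulr_suml. Qed.

Lemma sum_full_branches m n : \sum_(t <- full_branches m n) t.2 = n%:R / q.
Proof. by rewrite /full_branches big_map big_const_seq count_predT size_iota iter_addr_0 mulr_natl. Qed.

Section InvariantSet.
Variable Z : set R.
Hypothesis Z01 : forall z, Z z -> 0 <= z < 1.
Hypothesis ZT : forall z, Z z -> Z (greedy_map q z).

Lemma branch_gt0 d L : (forall t, t \in L -> 0 < t.2) ->
  forall t, t \in branch d L -> 0 < t.2.
Proof. by move=> L0 t /mapP[u uL ->]/=; rewrite divr_gt0// L0. Qed.

Lemma full_branches_gt0 m n t : t \in full_branches m n -> 0 < t.2.
Proof. by move=> /mapP[u uL ->]/=; rewrite invr_gt0. Qed.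

Lemma mem_branch L A x : affine_cover L Z A -> Z x -> A (greedy_map q x) ->
  exists2 t, t \in branch (digit q x) L & exists2 z, Z z & x = t.1 + t.2 * z.
Proof.
move=> [_ LA] Zx /(LA _ (ZT Zx))[t tL [z Zz e]].
exists (((digit q x)%:R + t.1) / q, t.2 / q); first by apply/mapP; exists t.
exists z => //=; rewrite [LHS](greedy_mapK hq) e; field; exact: qn0.
Qed.

Lemma mem_full_branches m n x : Z x -> (m <= digit q x < m + n)%N ->
  exists2 t, t \in full_branches m n & exists2 z, Z z & x = t.1 + t.2 * z.
Proof.
move=> Zx dx; exists ((digit q x)%:R / q, q^-1).
  by apply/mapP; exists (digit q x) => //; rewrite mem_iota.
exists (greedy_map q x); first exact: ZT.
by rewrite [LHS](greedy_mapK hq)/=; field; exact: qn0.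
Qed.

Lemma remainder_itv b : 0 <= b <= 1 -> 0 <= q * b - (digit q b)%:R <= 1.
Proof.
move=> /andP[b0 b1]; rewrite subr_ge0 digit_le//= lerBlDr addrC.
exact: le_digitS.
Qed.

(** Digits below that of [b] give whole branches; only the branch of [b] is cut, and the recursion
    enters it. One piece of ratio q^-K is wasted at the end. *)
Lemma affine_cover_left K b : 0 <= b <= 1 ->
  exists2 L, affine_cover L Z [set x | x < b] &
    \sum_(t <- L) t.2 <= b + q ^- K.
Proof.
elim: K b => [|K ih] b b01.
  exists [:: (0, 1)].
    split=> [t|x Zx _]; first by rewrite inE => /eqP ->.
    by exists (0, 1); [rewrite inE|exists x => //=; rewrite add0r mul1r].
  by rewrite big_seq1 expr0 invr1 lerDr; case/andP: b01.
have [L LA Ls] := ih _ (remainder_itv b01).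
set d := digit q b in LA Ls *.
exists (full_branches 0 d ++ branch d L); last first.
  rewrite big_cat/= sum_branch sum_full_branches -mulrDl ler_pdivrMr//.
  rewrite exprS invfM mulrDl mulrAC mulVf ?gt_eqF// mul1r.
  by move: Ls; lra.
split=> [t|x Zx /= xb].
  rewrite mem_cat => /orP[/full_branches_gt0//|].
  by apply: branch_gt0; case: LA.
have := le_digit hq (ltW xb); rewrite -/d leq_eqVlt => /orP[/eqP e|dx].
  have [||t tL tz] := @mem_branch _ _ x LA => //.
    by rewrite /= /greedy_map e ltrD2r ltr_pM2l.
  by exists t => //; rewrite mem_cat -e tL orbT.
have [|t tL tz] := @mem_full_branches 0 d x Zx; first by rewrite add0n.
by exists t => //; rewrite mem_cat tL.
Qed.

(** If [a] and [b] have the same digit, zoom in; otherwise both end branches are cut. Even [b = 1]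
    may cut its branch, so each level can add one wasted piece, whence [K.+1]. *)
Lemma affine_cover_itv K a b : 0 <= a -> a <= b -> b <= 1 ->
  exists2 L, affine_cover L Z [set x | a <= x < b] &
    \sum_(t <- L) t.2 <= b - a + K.+1%:R * q ^- K.
Proof.
elim: K a b => [|K ih] a b a0 ab b1.
  exists [:: (0, 1)].
    split=> [t|x Zx _]; first by rewrite inE => /eqP ->.
    by exists (0, 1); [rewrite inE|exists x => //=; rewrite add0r mul1r].
  by rewrite big_seq1 expr0 invr1 mulr1 lerDr subr_ge0.
have /andP[a'0 a'1] : 0 <= q * a - (digit q a)%:R <= 1.
  by apply: remainder_itv; rewrite a0 (le_trans ab).
have b'01 : 0 <= q * b - (digit q b)%:R <= 1.
  by apply: remainder_itv; rewrite b1 (le_trans a0).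
have qK : q ^- K.+1 * q = q ^- K.
  by rewrite exprS invfM mulrAC mulVf ?gt_eqF// mul1r.
have := le_digit hq ab; rewrite leq_eqVlt => /orP[/eqP dab|dab].
  have /andP[b'0 b'1] := b'01.
  have [|L LA Ls] := ih _ _ a'0 _ b'1; first by rewrite dab lerD2r ler_pM2l.
  exists (branch (digit q a) L); last first.
    rewrite sum_branch ler_pdivrMr// mulrDl -[_ * _ * q]mulrA qK.
    move: Ls; rewrite -dab -[K.+2%:R]natr1 [(_ + 1) * _]mulrDl mul1r.
    have : 0 < q ^- K by rewrite invr_gt0 exprn_gt0.
    lra.
  split=> [|x Zx /= /andP[ax xb]]; first by apply: branch_gt0; case: LA.
  have dx : digit q x = digit q a.
    apply/eqP; rewrite eqn_leq [X in (_ <= X)%N]dab.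
    by rewrite !le_digit// ltW.
  rewrite -dx; apply: mem_branch LA Zx _.
  by rewrite /= /greedy_map dx dab lerD2r ltrD2r ler_pM2l// ltr_pM2l// ax.
(* Distinct digits: the branch of [a] is covered up to its right end, the branches in between
   entirely, and that of [b] from its left end. *)
have [L1 L1A L1s] := ih _ _ a'0 a'1 (lexx 1).
have [L2 L2A L2s] := affine_cover_left K b'01.
set d1 := digit q a in dab a'0 a'1 L1A L1s *.
set d2 := digit q b in dab b'01 L2A L2s *.
exists (branch d1 L1 ++ full_branches d1.+1 (d2 - d1.+1) ++ branch d2 L2); last first.
  rewrite !big_cat/= !sum_branch sum_full_branches -!mulrDl ler_pdivrMr//.
  rewrite mulrDl -[_ * _ * q]mulrA qK natrB// -[K.+2%:R]natr1 [(_ + 1) * _]mulrDl mul1r.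
  rewrite -[d1.+1%:R]natr1; move: L1s L2s; lra.
split=> [t|x Zx /= /andP[ax xb]].
  rewrite !mem_cat => /or3P[|/full_branches_gt0//|].
    by apply: branch_gt0; case: L1A.
  by apply: branch_gt0; case: L2A.
have := le_digit hq ax; rewrite -/d1 leq_eqVlt => /orP[/eqP e|d1x].
  have [||t tL tz] := @mem_branch _ _ x L1A => //.
    have /andP[_ x1] := greedy_map_itv hq (Z01 Zx).
    by rewrite /= x1 andbT /greedy_map e lerD2r ler_pM2l.
  by exists t => //; rewrite !mem_cat e tL.
have := le_digit hq (ltW xb); rewrite -/d2 leq_eqVlt => /orP[/eqP e|xd2].
  have [||t tL tz] := @mem_branch _ _ x L2A => //.
    by rewrite /= /greedy_map e ltrD2r ltr_pM2l.
  by exists t => //; rewrite !mem_cat -e tL !orbT.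
have [|t tL tz] := @mem_full_branches d1.+1 (d2 - d1.+1) x Zx.
  by rewrite d1x/= subnKC.
by exists t => //; rewrite !mem_cat tL orbT.
Qed.

End InvariantSet.

Definition orbit_avoiding (a b : R) : set R :=
  [set x | 0 <= x < 1 /\ forall k, ~ (a <= iter k (greedy_map q) x < b)].

Lemma small_orbit_avoiding a b : 0 <= a -> a < b -> b <= 1 ->
  small 1 (orbit_avoiding a b) /\
  exists2 s, 0 < s < 1 & small s (orbit_avoiding a b).
Proof.
move=> a0 ab b1; set Z := orbit_avoiding a b.
have Z01 z : Z z -> 0 <= z < 1 by case.
have ZT z : Z z -> Z (greedy_map q z).
  move=> [z01 Zz]; split=> [|k]; first exact: greedy_map_itv.
  by rewrite -iterSr; exact: Zz.
(* The two covers waste (K + 2) q^-K in total; this [K] makes that less than the length [b - a]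
   saved by the hole. *)
have [K hK] := exp_gt_linear (b - a)^-1 hq.
have a01 : 0 <= a <= 1 by rewrite a0 (le_trans (ltW ab)).
have b0 : 0 <= b by rewrite (le_trans a0)// ltW.
have [L1 [L10 L1A] L1s] := affine_cover_left ZT K a01.
have [L2 [L20 L2A] L2s] := affine_cover_itv Z01 ZT K b0 b1 (lexx 1).
pose L := L1 ++ L2.
have L0 t : t \in L -> 0 < t.2 by rewrite mem_cat => /orP[/L10|/L20].
have L1' : \sum_(t <- L) t.2 < 1.
  rewrite big_cat /= (le_lt_trans (lerD L1s L2s))//.
  have : (K%:R + 4) * q ^- K < b - a.
    by move: hK; rewrite mulrC ltr_pdivrMr ?subr_gt0// mulrC -ltr_pdivrMr ?exprn_gt0.
  have : 0 < q ^- K by rewrite invr_gt0 exprn_gt0.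
  rewrite -[K.+1%:R]natr1 !mulrDl mul1r; lra.
have LZ x : Z x -> set0 x \/ exists2 t, t \in L & exists2 z, Z z & x = t.1 + t.2 * z.
  move=> Zx; right; have /andP[x0 x1] := Z01 _ Zx.
  have [xa|ax] := ltP x a.
    have [t tL tz] := L1A _ Zx xa; exists t => //; by rewrite mem_cat tL.
  have [xb|bx] := ltP x b.
    by case: Zx => _ /(_ 0%N) []; rewrite /= ax.
  have [|t tL tz] := L2A _ Zx _; first by rewrite /= bx.
  by exists t => //; rewrite mem_cat tL orbT.
have sZ s : 0 < s -> \sum_(t <- L) t.2 `^ s < 1 -> small s Z.
  move=> s0 Ls; apply: (@small_self_affine _ s Z set0 L 1) => //.
  - by move=> x /Z01 /andP[-> /ltW].
  - by move=> t /L0/ltW.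
  - exact: small_set0.
split.
  apply: sZ => //; rewrite big_seq; under eq_bigr => t tL do rewrite powRr1 ?(ltW (L0 _ tL))//.
  by rewrite -big_seq.
have [s s01 Ls] := contraction_exponent L0 L1'.
by exists s => //; apply: sZ => //; case/andP: s01.
Qed.

(** Branches are closed on the left, so digits persist to the right of [y]; to the left they may
    change at once. *)
Lemma right_cylinder m y : 0 <= y < 1 ->
  exists2 b, y < b <= 1 & forall z, y <= z < b -> forall i, (i < m)%N ->
    digit q (iter i (greedy_map q) z) = digit q (iter i (greedy_map q) y).
Proof.
elim: m y => [|m ih] y y01.
  by exists 1 => //; rewrite lexx andbT; case/andP: y01.
have [b' /andP[yb' b'1] hb'] := ih _ (greedy_map_itv hq y01).
have /andP[y0 y1] := y01.
set d := digit q y.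
(* The bound [b'] is pulled back through the branch of [y]; the cap at 1 handles an incomplete top
   branch. *)
exists (Num.min 1 ((d%:R + b') / q)).
  rewrite ge_min lexx/= lt_min y1 ltr_pdivlMr// mulrC andbT.
  by move: yb'; rewrite /greedy_map -/d; lra.
move=> z; rewrite lt_min => /and3P[yz z1]; rewrite ltr_pdivlMr// mulrC => zb.
have dz : digit q z = d.
  apply: (digit_uniq hq); rewrite ?digit_lt_ceil// ?(le_trans y0)//.
  apply/andP; split; last by lra.
  by rewrite (le_trans (digit_le hq y0))// ler_pM2l.
case=> [|i] im; first exact: dz.
rewrite !iterSr; apply: hb' => //; rewrite /greedy_map dz -/d.
by apply/andP; split; [rewrite lerD2r ler_pM2l|lra].
Qed.

Definition avoiding_word (w : seq nat) : set R :=
  [set x | Jq q x /\ forall k, exists2 i, (i < size w)%N &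
     digit q (iter (k + i) (greedy_map q) x) != nth 0%N w i].

Definition digit_word (y : R) (l m : nat) : seq nat :=
  mkseq (fun i => digit q (iter (l + i) (greedy_map q) y)) m.

Lemma not_word_occursE x y l m : ~ word_occurs q x y l m <->
  forall k, exists2 i, (i < size (digit_word y l m))%N &
    digit q (iter (k + i) (greedy_map q) x) != nth 0%N (digit_word y l m) i.
Proof.
rewrite size_mkseq; split=> [nocc k|h [k hk]].
  apply: contrapT => hk; apply: nocc; exists k => i im.
  rewrite !addn1 !addSn !greedyE//; apply/eqP/negP => /negP ne.
  by apply: hk; exists i; rewrite ?nth_mkseq.
have [i im] := h k; rewrite nth_mkseq// => /negP; apply; apply/eqP.
by have := hk _ im; rewrite !addn1 !addSn !greedyE.
Qed.

Lemma YvE y l m : Yv q y l m = avoiding_word (digit_word y l m).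
Proof. by apply/seteqP; split=> x [Jx] /not_word_occursE. Qed.

(** Points below 1 have orbits missing [a, b). A point [x >= 1] has the top digit and its image
    again avoids [w], so this part lies in one copy of the set, of ratio 1/q < 1. *)
Lemma small_avoiding_word s w a b :
  0 < s -> 0 <= a -> a < b -> b <= 1 ->
  (forall z, a <= z < b -> forall i, (i < size w)%N ->
    digit q (iter i (greedy_map q) z) = nth 0%N w i) ->
  small s (orbit_avoiding a b) -> small s (avoiding_word w).
Proof.
move=> s0 a0 ab b1 abw sZ.
have c1 := ceilq_gt1 hq.
have cE : (ceilq q)%:R - 1 = (ceilq q).-1%:R :> R.
  by rewrite -subn1 natrB// (ltn_trans _ c1).
apply: (@small_self_affine _ s _ _ [:: ((ceilq q).-1%:R / q, q^-1)]
  (((ceilq q)%:R - 1) / (q - 1)) s0 _ _ _ sZ).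
- by move=> x [].
- by move=> t; rewrite inE => /eqP ->/=; rewrite invr_ge0 ltW.
- have e1 : 1 `^ s = 1 :> R by rewrite powR1.
  rewrite big_seq1/= -[ltRHS]e1 gt0_ltr_powR ?nnegrE ?invr_ge0 ?ltW// invf_lt1//.
move=> x [/andP[x0 xJ] xw]; have [x1|x1] := ltP x 1.
  left; split=> [|k kab]; first by rewrite x0.
  have [i iw /eqP] := xw k; apply.
  by rewrite addnC iterD; apply: abw.
right; exists ((ceilq q).-1%:R / q, q^-1); first by rewrite inE.
have dx := digit_ge1 hq x1.
exists (greedy_map q x); last first.
  by rewrite /= [LHS](greedy_mapK hq) dx; field; exact: qn0.
split=> [|k].
  rewrite /Jq /= /greedy_map subr_ge0 digit_le//= dx -cE.
  move: xJ; rewrite !ler_pdivlMr ?subr_gt0//.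
  have : 0 < q - 1 by rewrite subr_gt0.
  nra.
by have [i iw h] := xw k.+1; exists i => //; rewrite -iterSr.
Qed.

Lemma small_Yv y l m : 0 <= y < 1 ->
  small 1 (Yv q y l m) /\ exists2 s, 0 < s < 1 & small s (Yv q y l m).
Proof.
move=> y01; rewrite YvE.
have y'01 := iter_greedy_map_itv hq l y01.
have [b /andP[yb b1] hb] := right_cylinder m y'01.
have /andP[y'0 _] := y'01.
have [s1 [s s01 ss]] := small_orbit_avoiding y'0 yb b1.
have H s' : 0 < s' -> small s' (orbit_avoiding (iter l (greedy_map q) y) b) ->
    small s' (avoiding_word (digit_word y l m)).
  move=> s'0; apply: small_avoiding_word => // z zb i; rewrite size_mkseq => im.
  by rewrite nth_mkseq// hb// addnC iterD.
split; first exact: H.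
by exists s => //; apply: H => //; case/andP: s01.
Qed.

(** Only the word matters, not [y], and there are countably many words. *)
Lemma Yset_countable_cover : exists2 F : nat -> set R,
  forall n, small 1 (F n) & Yset q `<=` \bigcup_n F n.
Proof.
(* The test discards words whose set is not known to be small, since the enumeration also runs
   through words that come from no [y]. *)
exists (fun n => if @unpickle (seq nat) n is Some w then
  if `[< small 1 (avoiding_word w) >] then avoiding_word w else set0 else set0).
  move=> n; case: unpickle => [w|]; last exact: small_set0.
  by case: asboolP => // _; exact: small_set0.
move=> x [Jx [y [l [m [y01 m0 nocc]]]]].
exists (pickle (digit_word y l m)) => //; rewrite pickleK.
have [s1 _] := small_Yv l m y01; rewrite YvE in s1.
case: asboolP => // _; rewrite -YvE; by split.
Qed.

End AvoidingOrbits.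

(** * A lower bound for Hausdorff measure *)

(* An inverse Hoelder map pulls a cover of [A] back to a cover of [[0, 1[],
   whose Lebesgue measure bounds the cost from below. *)
Lemma hausdorff_measure_neq0 (R : realType) (s c : R) (A : set R) (f : R -> R) :
  0 <= s -> 0 < c -> (forall u, 0 <= u < 1 -> A (f u)) ->
  (forall u v, 0 <= u < 1 -> 0 <= v < 1 -> u != v ->
     c * `|u - v| <= `|f u - f v| `^ s) ->
  hausdorff_measure s A <> 0%E.
Proof.
move=> s0 c0 fA fH H0.
suff : ((c / 2)%:E <= hausdorff_measure s A)%E.
  by rewrite H0 lee_fin leNgt divr_gt0.
(* One scale bounds the supremum from below; at scale 1 the sets are bounded, so [diam] is a genuine
   supremum. *)
apply: le_ereal_sup_tmp; exists (hausdorff_pre s 1 A); first by exists 1 => //=.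
apply: le_ereal_inf_tmp => _ [U [AU dU] <-].
have hc0 i : 0 <= hcost s (U i).
  by rewrite /hcost; case: asboolP => // _; exact: powR_ge0.
pose V i := [set u | 0 <= u < 1 /\ U i (f u)].
pose r i := hcost s (U i) / c.
have r0 i : 0 <= r i by rewrite divr_ge0// ltW.
(* The centre is a point of [V i] (0 if there is none), the radius comes from the Hoelder bound. The
   length 2 * cost / c accounts for the constant [c / 2]. *)
pose B i := `[xget 0 (V i) - r i, xget 0 (V i) + r i]%classic : set R.
have VB i : V i `<=` B i.
  move=> u Vu; have [v01 Uv] : V i (xget 0 (V i)) by apply: xgetPex; exists u.
  case: Vu => u01 Uu; rewrite /B /= in_itv/=; set v := xget _ _ in v01 Uv *.
  suff : `|u - v| <= r i by rewrite ler_norml => /andP[? ?]; apply/andP; split; lra.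
  have [->|uv] := eqVneq u v; first by rewrite subrr normr0.
  rewrite ler_pdivlMr// mulrC (le_trans (fH _ _ u01 v01 uv))//.
  rewrite /hcost; case: asboolP => [U0|_]; first by move: Uu; rewrite U0.
  have : `|f u - f v| <= diam (U i).
    apply: ub_le_sup; last by exists (f u) => //; exists (f v).
    by exists 1 => _ [x Ux [y Uy <-]]; exact: (dU i).
  by move=> h; apply: ge0_ler_powR => //; rewrite nnegrE// (le_trans _ h).
have : (lebesgue_measure (`[0%R, 1%R[%classic : set R) <=
    \sum_(0 <= i <oo) lebesgue_measure (B i))%E.
  apply: measure_sigma_subadditive.
  - by move=> i; exact: measurable_itv.
  - exact: measurable_itv.
  move=> u; rewrite /= in_itv/= => u01.
  by have [i _ Ui] := AU _ (fA _ u01); exists i => //; apply: VB.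
rewrite lebesgue_measure_itv/= lte_fin ltr01 sube0 => h1.
have : (1%:E <= \sum_(0 <= i <oo) (2 / c)%:E * (hcost s (U i))%:E)%E.
  apply: (le_trans h1); apply: lee_nneseries => [i _ _|i _]; first exact: measure_ge0.
  rewrite lebesgue_measure_itv/= lte_fin; case: ifP => _.
    rewrite -EFinB -EFinM lee_fin /r le_eqVlt; apply/orP; left; apply/eqP; field.
    by rewrite gt_eqF.
  by rewrite -EFinM lee_fin mulr_ge0// divr_ge0// ltW.
rewrite nneseriesZl; last by move=> i _; rewrite lee_fin.
have c2 : 0 < 2 / c by rewrite divr_gt0.
rewrite -(@lee_pdivrMl _ _ _ _ c2) mule1 invf_div //.
Qed.

(** * Full intervals, Cantor sets inside Y, and the dimension of Y *)

Section FullIntervals.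
Variables (R : realType) (q : R).
Hypothesis hq : 1 < q.

Let q0 : 0 < q. Proof. exact: lt_trans ltr01 hq. Qed.

Let qX0 n : 0 < q ^+ n. Proof. exact: exprn_gt0. Qed.

Let qV0 n : 0 < q ^- n. Proof. by rewrite invr_gt0. Qed.

Let qV1 n : q ^- n <= 1.
Proof. by rewrite invf_le1// exprn_ege1// ltW. Qed.

Definition full (n : nat) (p : R) : Prop :=
  forall t, 0 <= t < 1 -> iter n (greedy_map q) (p + q ^- n * t) = t.

Lemma full_branch n p d : (d < ceilq q)%N -> 0 <= p -> p + q ^- n <= 1 ->
  full n p -> full n.+1 ((d%:R + p) / q).
Proof.
move=> dc p0 p1 fp t /andP[t0 t1].
have -> : (d%:R + p) / q + q ^- n.+1 * t = (d%:R + (p + q ^- n * t)) / q.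
  by rewrite exprS invfM; ring.
rewrite iterSr greedy_map_branch ?fp ?t0//.
rewrite addr_ge0 ?mulr_ge0 ?(ltW (qV0 _))//= (lt_le_trans _ p1)// ltrD2l.
by rewrite gtr_pMr.
Qed.

Lemma full0 n : full n 0.
Proof.
elim: n => [|n ih]; first by move=> t _; rewrite add0r expr0 invr1 mul1r.
rewrite -[0 : R](mul0r q^-1) -[X in X / q]addr0 -[X in X + _](mulr0n 1).
apply: full_branch => //; last by rewrite add0r.
exact: ltn_trans (ceilq_gt1 hq).
Qed.

(** Scaling by [q] gives length at least (n + 2) q^-n, and entering a single branch loses at most
    q^-n of it. This loss per digit is why the factor is linear in [n]. *)
Lemma exists_full n a b : 0 <= a -> b <= 1 -> n.+1%:R * q ^- n <= b - a ->
  exists p, [/\ a <= p, p + q ^- n <= b & full n p].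
Proof.
elim: n a b => [|n ih] a b a0 b1 ab.
  move: ab; rewrite expr0 invr1 mulr1 => ab.
  exists 0; split; [lra|lra|exact: full0].
set w := q ^- n; have w0 : 0 < w := qV0 n.
have qw : q * q ^- n.+1 = w by rewrite exprS invfM mulrA mulfV ?mul1r// gt_eqF.
have qab : n%:R * w + 2 * w <= q * b - q * a.
  rewrite -mulrBr -mulrDl -qw mulrCA ler_pM2l//.
  by apply: le_trans ab; rewrite -[n.+2]addn2 natrD.
have nw : 0 <= n%:R * w by rewrite mulr_ge0// ltW.
have b0 : 0 <= b.
  have : 0 <= n.+2%:R * q ^- n.+1 by rewrite mulr_ge0// ltW.
  by move: ab a0; lra.
set e := digit q b.
have eb : e%:R <= q * b := digit_le hq b0.
have be : q * b <= e%:R + 1 := le_digitS hq b1.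
have ec : (e < ceilq q)%N := digit_lt_ceil hq b.
have sw p : (p / q + q ^- n.+1) * q = p + w.
  by rewrite mulrDl divfK ?gt_eqF// [q ^- _ * q]mulrC qw.
(* Two sources of full intervals: the induction hypothesis inside the branch of [d] ([zoom]), and
   the word [d] followed by [n] zeros ([atom]). *)
have zoom d a' b' : (d < ceilq q)%N -> 0 <= a' -> b' <= 1 ->
    n.+1%:R * w <= b' - a' -> q * a <= d%:R + a' -> d%:R + b' <= q * b ->
    exists p, [/\ a <= p, p + q ^- n.+1 <= b & full n.+1 p].
  move=> dc a'0 b'1 hab ha hb; have [p [ap pb fp]] := ih _ _ a'0 b'1 hab.
  exists ((d%:R + p) / q); split.
  - by rewrite ler_pdivlMr// mulrC; lra.
  - by rewrite -(ler_pM2r q0) sw [b * q]mulrC; rewrite -/w in pb; lra.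
  - by apply: full_branch => //; [exact: le_trans ap|exact: le_trans pb b'1].
have atom d : (d < ceilq q)%N -> q * a <= d%:R -> d%:R + w <= q * b ->
    exists p, [/\ a <= p, p + q ^- n.+1 <= b & full n.+1 p].
  move=> dc ha hb; exists ((d%:R + 0) / q); split.
  - by rewrite addr0 ler_pdivlMr// mulrC.
  - by rewrite -(ler_pM2r q0) sw [b * q]mulrC addr0.
  - by apply: full_branch => //; [rewrite add0r; exact: qV1|exact: full0].
have n1 : n.+1%:R = n%:R + 1 :> R by rewrite natr1.
(* Either the scaled interval lies in the branch of [e], or [e] is inside it, and then the word e
   0^n fits if there is room [w] above [e]. *)
have [ea|ae] := lerP e%:R (q * a).
  by apply: (zoom e (q * a - e%:R) (q * b - e%:R)) => //; rewrite ?n1; lra.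
have [ew|we] := lerP w (q * b - e%:R); first by apply: (atom e) => //; lra.
have e0 : (0 < e)%N by rewrite -(ltr_nat R) (le_lt_trans _ ae)// mulr_ge0// ltW.
have eE : e%:R = e.-1%:R + 1 :> R by rewrite natr1 prednK.
have e1c : (e.-1 < ceilq q)%N by rewrite (leq_ltn_trans _ ec)// leq_pred.
have w1 : w <= 1 := qV1 n.
(* Less than [w] lies above [e], so the part below keeps length (n + 1) w: it lies in the branch of
   [e.-1] or contains all of it. *)
have [ea|ae'] := lerP e.-1%:R (q * a).
  by apply: (zoom e.-1 (q * a - e.-1%:R) 1) => //; rewrite ?n1; lra.
by apply: (atom e.-1) => //; lra.
Qed.

Lemma iter_greedy_map_digit0 n x :
  (forall i, (i < n)%N -> digit q (iter i (greedy_map q) x) = 0%N) ->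
  iter n (greedy_map q) x = q ^+ n * x.
Proof.
elim: n => [|n ih] h; first by rewrite expr0 mul1r.
rewrite iterS ih => [|i /ltnW]; last exact: h.
have := h n (ltnSn n); rewrite ih => [|i /ltnW]; last exact: h.
by rewrite /greedy_map => ->; rewrite subr0 exprS mulrA.
Qed.

(* A Cantor set all of whose points are concatenations of the [M] full words of
   length [n] that start at the points [p i], none of which is [0^n]. *)
Section CantorSet.
Variables (n M : nat) (p : nat -> R).
Hypothesis M2 : (1 < M)%N.
Hypothesis p_ge : forall i, (i < M)%N -> q ^- n <= p i.
Hypothesis p_le : forall i, (i < M)%N -> p i + 2 * q ^- n <= 1.
Hypothesis p_full : forall i, (i < M)%N -> full n (p i).
Hypothesis p_gap : forall i j, (i < j)%N -> (j < M)%N -> p i + 2 * q ^- n <= p j.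

Let rho : R := q ^- n.

Let rho0 : 0 < rho. Proof. exact: qV0. Qed.

Let M0 : 0 < M%:R :> R. Proof. by rewrite ltr0n (ltn_trans _ M2). Qed.

(** The base-[M] digits of [u] select the successive pieces, so [0, 1) parametrises the Cantor
    set. *)
Definition base_digit (u : R) : nat := Num.truncn (M%:R * u).

Definition base_shift (u : R) : R := M%:R * u - (base_digit u)%:R.

Lemma base_digit_lt u : 0 <= u < 1 -> (base_digit u < M)%N.
Proof.
move=> /andP[u0 u1]; rewrite /base_digit truncn_lt_nat ?mulr_ge0//.
by rewrite gtr_pMr.
Qed.

Lemma base_shift_itv u : 0 <= u < 1 -> 0 <= base_shift u < 1.
Proof.
move=> /andP[u0 u1]; have Mu0 : 0 <= M%:R * u by rewrite mulr_ge0// ltW.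
rewrite /base_shift /base_digit subr_ge0 truncn_le Mu0 ltrBlDr addrC natr1.
exact: truncnS_gt.
Qed.

Fixpoint cantor_psum (N : nat) (u : R) : R :=
  if N is N'.+1 then p (base_digit u) + rho * cantor_psum N' (base_shift u) else 0.

Definition cantor_point (u : R) : R := limn (cantor_psum^~ u).

(** The margin [rho] makes the bound survive the limit, which must stay in [0, 1) for [full] to
    apply. *)
Lemma cantor_psum_itv N u : 0 <= u < 1 -> 0 <= cantor_psum N u <= 1 - rho.
Proof.
elim: N u => [|N ih] u u01 /=.
  rewrite lexx subr_ge0; exact: qV1.
have /andP[h0 h1] := ih _ (base_shift_itv u01).
have := p_ge (base_digit_lt u01); have := p_le (base_digit_lt u01).
rewrite -/rho => pl pg; apply/andP; split.
  by rewrite addr_ge0 ?mulr_ge0// ltW// (lt_le_trans rho0).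
have : rho * cantor_psum N (base_shift u) <= rho.
  by rewrite ger_pMr// (le_trans h1)// gerBl ltW.
lra.
Qed.

Lemma cantor_psum_cvg u : 0 <= u < 1 -> cantor_psum^~ u @ \oo --> cantor_point u.
Proof.
move=> u01; apply: nondecreasing_is_cvgn; last first.
  by exists (1 - rho) => _ [N _ <-]; case/andP: (cantor_psum_itv N u01).
apply/nondecreasing_seqP => N; elim: N u u01 => [|N ih] u u01.
  by case/andP: (cantor_psum_itv 1 u01).
rewrite [leLHS]/= [leRHS]/= lerD2l ler_wpM2l ?(ltW rho0)//; apply: ih.
exact: base_shift_itv.
Qed.

Lemma cantor_point_itv u : 0 <= u < 1 -> 0 <= cantor_point u <= 1 - rho.
Proof.
move=> u01; have cv := cantor_psum_cvg u01; apply/andP; split.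
  by apply: limr_ge; [exact: cvgP cv|apply: nearW => N; case/andP: (cantor_psum_itv N u01)].
by apply: limr_le; [exact: cvgP cv|apply: nearW => N; case/andP: (cantor_psum_itv N u01)].
Qed.

Lemma cantor_point_itv01 u : 0 <= u < 1 -> 0 <= cantor_point u < 1.
Proof.
move=> /cantor_point_itv/andP[-> h]; rewrite (le_lt_trans h)//.
by rewrite gtrBl.
Qed.

Lemma cantor_pointE u : 0 <= u < 1 ->
  cantor_point u = p (base_digit u) + rho * cantor_point (base_shift u).
Proof.
move=> u01; apply: (@cvg_unique _ _ ((fun N => cantor_psum N.+1 u) @ \oo)) => //.
  by have := cantor_psum_cvg u01; rewrite -(cvg_shiftS (cantor_psum^~ u)).
apply: cvgD; first exact: cvg_cst.
by apply: cvgMl_tmp; apply: cantor_psum_cvg; exact: base_shift_itv.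
Qed.

Lemma iter_cantor_point j u : 0 <= u < 1 ->
  exists2 v, 0 <= v < 1 & iter (j * n) (greedy_map q) (cantor_point u) = cantor_point v.
Proof.
elim: j u => [|j ih] u u01; first by exists u.
have [v v01 vE] := ih _ (base_shift_itv u01); exists v => //.
rewrite -vE mulSn addnC iterD; congr iter.
rewrite cantor_pointE// p_full ?base_digit_lt//.
by apply: cantor_point_itv01; exact: base_shift_itv.
Qed.

(** A run of 2n zeros contains a whole block. The orbit point at the start of that block is at least
    q^-n, while [n] zero digits force it below q^-n. *)
Lemma cantor_point_Yset u : 0 <= u < 1 -> Yset q (cantor_point u).
Proof.
move=> u01; have /andP[h0 h1] := cantor_point_itv01 u01.
have n0 : (0 < n)%N.
  rewrite lt0n; apply/eqP => nE; have := p_le (base_digit_lt u01).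
  have := p_ge (base_digit_lt u01); rewrite nE expr0 invr1; lra.
split.
  rewrite /Jq /= h0 (le_trans (ltW h1))// ler_pdivlMr ?subr_gt0// mul1r.
  by rewrite lerD2r ceilq_ge.
exists 0, 0%N, (n + n)%N; split; rewrite ?lexx ?ltr01 ?addn_gt0 ?n0// => -[k hk].
(* [j * n] is the first block boundary beyond [k]; it is at most [k + n], so the block ends within
   the run. *)
set j := (k %/ n).+1.
have kj : (k < j * n)%N by rewrite ltn_ceil.
have jk : (j * n <= k + n)%N by rewrite mulSn addnC leq_add2r leq_divM.
have digit0 i : digit q (iter i (greedy_map q) 0) = 0%N.
  have m0 : greedy_map q 0 = 0.
    rewrite /greedy_map (digit_uniq hq (d := 0%N)) ?mulr0 ?subr0 ?lexx ?add0r ?ltr01//.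
    exact: ltn_trans (ceilq_gt1 hq).
  have -> : iter i (greedy_map q) 0 = 0 by elim: i => //= i ->.
  by apply: digit_uniq; rewrite ?mulr0 ?lexx ?add0r ?ltr01// (ltn_trans _ (ceilq_gt1 hq)).
have [v v01 vE] := iter_cantor_point j u01.
have : iter n (greedy_map q) (cantor_point v) = q ^+ n * cantor_point v.
  apply: iter_greedy_map_digit0 => i lin.
  have /hk : (j * n - k + i < n + n)%N.
    by rewrite -addnS leq_add// leq_subLR.
  rewrite !addn1 !addSn !greedyE// digit0 -vE -iterD => <-.
  by congr (digit q (iter _ _ _)); rewrite addnA subnKC ?(ltnW kj)// addnC.
move=> e; have /andP[_] := iter_greedy_map_itv hq n (cantor_point_itv01 v01).
rewrite e ltNge => /negP; apply.
rewrite mulrC -ler_pdivrMr// div1r cantor_pointE// -[leLHS]addr0 lerD//.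
  exact: p_ge (base_digit_lt v01).
rewrite mulr_ge0 ?(ltW rho0)//.
by case/andP: (cantor_point_itv (base_shift_itv v01)).
Qed.

(** Left ends are 2 rho apart, and a piece takes up at most [rho] of that. *)
Lemma cantor_point_gap u v : 0 <= u < 1 -> 0 <= v < 1 ->
  (base_digit u < base_digit v)%N -> rho <= cantor_point v - cantor_point u.
Proof.
move=> u01 v01 uv; rewrite (cantor_pointE u01) (cantor_pointE v01).
have := p_gap uv (base_digit_lt v01); rewrite -/rho.
have /andP[hv _] := cantor_point_itv01 (base_shift_itv v01).
have /andP[_ hu] := cantor_point_itv01 (base_shift_itv u01).
have : 0 <= rho * cantor_point (base_shift v) by rewrite mulr_ge0// ltW.
have : rho * cantor_point (base_shift u) <= rho by rewrite ger_pMr// ltW.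
lra.
Qed.

(** If the first base-[M] digits differ, the gap [rho] suffices. Otherwise the shift multiplies |u -
    v| by [M] and the distance of the points by 1/rho, and M rho^s >= 1 preserves the inequality. *)
Lemma cantor_point_holder s u v : 0 <= s -> 1 <= M%:R * rho `^ s ->
  0 <= u < 1 -> 0 <= v < 1 -> u != v ->
  rho `^ s * `|u - v| <= `|cantor_point u - cantor_point v| `^ s.
Proof.
move=> s0 Ms u01 v01 uv.
(* [k] bounds the number of shifts: each multiplies |u - v| by [M], and it can never reach 1. *)
have [k hk] : exists k, M%:R ^- k <= `|u - v|.
  have uv0 : 0 < `|u - v| by rewrite normr_gt0 subr_eq0.
  have M1 : 1 < M%:R :> R by rewrite ltr1n.
  have [k hk] := exp_gt_linear `|u - v|^-1 M1; exists k.
  rewrite -[leRHS]invrK lef_pV2 ?posrE ?invr_gt0 ?exprn_gt0//.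
  rewrite (le_trans _ (ltW hk))// ler_peMr ?invr_ge0// -[leLHS]add0r lerD//.
  by rewrite ler1n.
elim: k u v u01 v01 hk {uv} => [|k ih] u v u01 v01.
  rewrite expr0 invr1 => h; exfalso.
  have : `|u - v| < 1 by rewrite ltr_norml; move: u01 v01 => /andP[? ?] /andP[? ?]; apply/andP; split; lra.
  by rewrite ltNge h.
move=> hk; have rs0 : 0 < rho `^ s by exact: powR_gt0.
have far w : rho <= w -> rho `^ s * `|u - v| <= w `^ s.
  move=> hw; apply: (@le_trans _ _ (rho `^ s)).
    rewrite ger_pMr// ltW// ltr_norml.
    by move: u01 v01 => /andP[? ?] /andP[? ?]; apply/andP; split; lra.
  by apply: ge0_ler_powR; rewrite ?nnegrE// ltW// (lt_le_trans rho0).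
have [duv|duv|duv] := ltngtP (base_digit u) (base_digit v).
- by apply: far; rewrite distrC (le_trans (cantor_point_gap u01 v01 duv))// ler_norm.
- by apply: far; rewrite (le_trans (cantor_point_gap v01 u01 duv))// ler_norm.
have uvS : `|base_shift u - base_shift v| = M%:R * `|u - v|.
  rewrite /base_shift duv opprB addrA subrK -mulrBr normrM.
  by rewrite (ger0_norm (ltW M0)).
have := ih _ _ (base_shift_itv u01) (base_shift_itv v01).
rewrite uvS => /(_ _)/wrap[].
  by rewrite -ler_pdivrMl// -invfM mulrC -exprSr.
move=> h.
rewrite (cantor_pointE u01) (cantor_pointE v01) duv opprD addrACA subrr add0r -mulrBr.
rewrite normrM (ger0_norm (ltW rho0)) powRM ?(ltW rho0)// ler_pM2l//.
apply: le_trans h; rewrite mulrA ler_peMl// mulrC //.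
Qed.

End CantorSet.

(** About q^n / (n + 4) pieces of ratio q^-n fit, so M rho^s is about q^(n (1 - s)) / (n + 4), which
    is large for large [n]. *)
Lemma Yset_hausdorff_measure_neq0 s : 0 <= s -> s < 1 ->
  hausdorff_measure s (Yset q) <> 0%E.
Proof.
move=> s0 s1.
have th1 : 1 < q `^ (1 - s).
  have e1 : 1 `^ (1 - s) = 1 :> R by rewrite powR1.
  by rewrite -[ltLHS]e1 gt0_ltr_powR ?nnegrE ?subr_gt0// ltW.
(* The factor 2 absorbs truncation: X rho^s > 2, M > X - 1 and rho^s <= 1 give M rho^s >= 1. *)
have [n hn] := exp_gt_linear 2 th1.
set rho := q ^- n; have rho0 : 0 < rho := qV0 n.
have thE : (q `^ (1 - s)) ^+ n = q ^+ n * rho `^ s.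
  rewrite -powR_mulrn ?powR_ge0// powRAC powR_mulrn ?(ltW q0)//.
  rewrite powRD; last by apply/implyP => _; rewrite gt_eqF.
  rewrite powRr1 ?(ltW (qX0 _))// /rho -powR_inv1 ?(ltW (qX0 _))//.
  by rewrite -powRrM mulN1r.
have rs0 : 0 < rho `^ s := powR_gt0 s rho0.
have rs1 : rho `^ s <= 1.
  have e1 : 1 `^ s = 1 :> R by rewrite powR1.
  by rewrite -[leRHS]e1 ge0_ler_powR ?nnegrE ?ler01 ?(ltW rho0)//; exact: qV1.
have N0 : 0 < n%:R + 4 :> R by rewrite ltr_wpDl.
pose X := q ^+ n / (n%:R + 4).
have X0 : 0 < X by rewrite divr_gt0.
have XN : X * (n%:R + 4) = q ^+ n by rewrite divfK// gt_eqF.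
have X2s : 2 < X * rho `^ s.
  by rewrite /X mulrAC ltr_pdivlMr// -thE.
have X2 : 2 < X by rewrite (lt_le_trans X2s)// ger_pMr.
pose M := Num.truncn X.
have MX : M%:R <= X by rewrite truncn_le ltW.
have XM : X < M%:R + 1 by rewrite natr1 truncnS_gt.
have M2 : (1 < M)%N by rewrite -(ltr_nat R); lra.
have Ms : 1 <= M%:R * rho `^ s by nra.
have Mrho : M%:R * (n%:R + 4) * rho <= 1.
  by rewrite /rho ler_pdivrMr// mul1r -XN ler_pM2r.
(* A window of length (n + 1) rho starting at [a i] contains a full interval; the spacing (n + 4)
   rho leaves the gaps, and the initial [rho] keeps the pieces away from 0. *)
pose a i := rho * (1 + (n%:R + 4) * i%:R).
have room i : (i < M)%N -> a i + (n%:R + 3) * rho <= 1.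
  move=> iM; apply: le_trans Mrho.
  have : (i%:R + 1) * (n%:R + 4) <= M%:R * (n%:R + 4) :> R.
    by rewrite ler_pM2r// natr1 ler_nat.
  by move=> h; rewrite /a [rho * _]mulrC -mulrDl ler_pM2r//; lra.
have exp i : exists x, (i < M)%N ->
    [/\ a i <= x, x + rho <= a i + n.+1%:R * rho & full n x].
  case: (ltnP i M) => [iM|_]; last by exists 0.
  have ai0 : 0 <= a i by rewrite mulr_ge0 ?(ltW rho0)// addr_ge0// mulr_ge0// ltW.
  have [|||x [ax xb fx]] := @exists_full n (a i) (a i + n.+1%:R * rho) => //.
  - by move: (room i iM); rewrite -natr1; lra.
  - by rewrite addrAC subrr add0r.
  by exists x.
have [p hp] := choice exp.
have n1 : n.+1%:R = n%:R + 1 :> R by rewrite natr1.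
have nr : 0 <= n%:R * rho by rewrite mulr_ge0// ltW.
have p_ge i : (i < M)%N -> rho <= p i.
  move=> /hp[ax _ _]; apply: le_trans ax.
  by rewrite /a mulrDr mulr1 lerDl mulr_ge0 ?(ltW rho0)// mulr_ge0// ltW.
have p_le i : (i < M)%N -> p i + 2 * rho <= 1.
  move=> iM; have [_ xb _] := hp _ iM; have := room _ iM.
  by move: xb; rewrite n1; lra.
have p_full i : (i < M)%N -> full n (p i) by move=> /hp[].
have p_gap i j : (i < j)%N -> (j < M)%N -> p i + 2 * rho <= p j.
  move=> ij jM; have [_ pi _] := hp _ (ltn_trans ij jM); have [pj _ _] := hp _ jM.
  have : a i + (n%:R + 4) * rho <= a j.
    rewrite /a [_ * rho]mulrC -mulrDr ler_pM2l// -addrA -[X in _ + (_ + X)]mulr1.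
    by rewrite -mulrDr lerD2l ler_pM2l// natr1 ler_nat.
  by move: pi pj; rewrite n1; lra.
apply: (hausdorff_measure_neq0 (f := cantor_point n M p) s0 rs0).
  by move=> u; exact: cantor_point_Yset.
by move=> u v u01 v01 uv; exact: cantor_point_holder.
Qed.

Lemma Yset_hausdorff_dim : hausdorff_dim (Yset q) = 1%:E.
Proof.
apply/eqP; rewrite eq_le; apply/andP; split; last first.
  apply: le_ereal_inf_tmp => _ [s [s0 sY] <-]; rewrite lee_fin leNgt; apply/negP => s1.
  exact: Yset_hausdorff_measure_neq0 sY.
apply/lee_addgt0Pr => e e0; rewrite -EFinD.
have e1 : 1 < 1 + e by rewrite ltrDl.
apply: hausdorff_dim_le; first exact: lt_trans e1.
by apply: sub_small (small_bounded (((ceilq q)%:R - 1) / (q - 1)) e1) => x [].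
Qed.

End FullIntervals.

Unset Implicit Arguments.

Theorem theorem2p8 (R : realType) (q : R) (hq : 1 < q) :
  (forall (y : R) (l m : nat), 0 <= y < 1 -> (0 < m)%N ->
     (hausdorff_dim (Yv q y l m) < 1%:E)%E) /\
  [/\ first_category (Yset q),
      (@lebesgue_measure R).-negligible (Yset q)
    & hausdorff_dim (Yset q) = 1%:E].
Proof.
split=> [y l m y01 _|].
  have [_ [s /andP[s0 s1] sY]] := small_Yv hq l m y01.
  by apply: le_lt_trans (hausdorff_dim_le s0 sY) _; rewrite lte_fin.
have [F sF YF] := Yset_countable_cover hq; split.
- by exists F; split=> // n; exact: small1_nowhere_dense.
- have nF : (@lebesgue_measure R).-negligible (\bigcup_n F n).
    by apply: negligible_bigcup => n; exact: small1_negligible.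
  exact: negligibleS nF.
- exact: Yset_hausdorff_dim.
Qed.
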